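(* Let $X$ be a dual operator space and let $S$ be an amenable semigroup (under composition) of completely contractive, weak$^*$-continuous linear mappings $X\to X$. If $X$ is an injective operator space, then the fixed point space $X^S=\{x\in X\mid s(x)=x\text{ for all }s\in S\}$ is also an injective operator space.
   Context: A dual operator space is an operator space $X$ of the form $X=(X_* )^*$ (operator space dual) for some operator space $X_*$; the weak$^*$-topology is the one given by $X_*$. An operator space $Y$ is injective if for every complete isometry $\varphi\colon X_0\to X_1$ of operator spaces and every completely bounded $\psi_0\colon X_0\to Y$ there is a completely bounded $\psi\colon X_1\to Y$ with $\psi\circ\varphi=\psi_0$ and $\|\psi\|_{\mathrm{cb}}=\|\psi_0\|_{\mathrm{cb}}$. A semigroup $S$ is amenable if, on the space $\mathcal F_b(S)$ of all bounded functions $S\to\mathbb C$ with the sup norm, there is a linear functional $\mu$ with $\|\mu\|=\mu(\mathbf 1)=1$ and $\mu(L_tf)=\mu(f)$ for all $t\in S$ and $f\in\mathcal F_b(S)$, where $(L_tf)(s)=f(ts)$. $X^S$ carries the operator space structure inherited from $X$. *)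

(* Defs.v *)
From HB Require Import structures.
From mathcomp Require Import all_boot all_order all_algebra.
From mathcomp Require Import complex ring.
From mathcomp Require Import all_classical all_reals all_analysis.

Set Implicit Arguments.
Unset Strict Implicit.
Unset Printing Implicit Defensive.

Import Order.TTheory GRing.Theory Num.Theory.
Import numFieldNormedType.Exports.

Local Open Scope classical_set_scope.
Local Open Scope ring_scope.

Notation normc := ComplexField.Normc.normc.

(* Hilbert space norm on C^n, and the norm of a complex m x n matrix as an
   operator from C^n to C^m; the matrix norm is real-valued because the set
   under the supremum is nonempty and bounded. *)
Definition l2norm (R : realType) n (v : 'cV[R[i]]_n) : R :=
  Num.sqrt (\sum_i normc (v i 0) ^+ 2).

Definition opnorm (R : realType) m n (A : 'M[R[i]]_(m, n)) : R :=
  sup [set l2norm (A *m v) | v in [set v : 'cV_n | l2norm v <= 1]].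

(* alpha x beta, for x a matrix over a complex vector space *)
Definition mxact (R : realType) (V : lmodType R[i]) m n
    (a : 'M[R[i]]_(m, n)) (x : 'M[V]_n) (b : 'M[R[i]]_(n, m)) : 'M[V]_m :=
  \matrix_(i, j) \sum_k \sum_l (a i k * b l j) *: x k l.

(* Operator spaces in the abstract (Ruan) form: norms on all the M_n(V)
   satisfying ||x (+) y|| = max(||x||, ||y||) and
   ||a x b|| <= ||a|| ||x|| ||b||. No completeness is required. *)
HB.mixin Record isOperatorSpace (R : realType) (V : Type)
    of GRing.Lmodule R[i] V := {
  mxnorm : forall n, 'M[V]_n -> R;
  mxnorm_eq0 : forall n (x : 'M[V]_n), mxnorm n x = 0 -> x = 0;
  mxnormD : forall n (x y : 'M[V]_n),
    mxnorm n (x + y) <= mxnorm n x + mxnorm n y;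
  mxnormZ : forall n (c : R[i]) (x : 'M[V]_n),
    mxnorm n (map_mx ( *:%R c) x) = normc c * mxnorm n x;
  mxnorm_block : forall m n (x : 'M[V]_m) (y : 'M[V]_n),
    mxnorm (m + n)%N (block_mx x 0 0 y) = Num.max (mxnorm m x) (mxnorm n y);
  mxnorm_act : forall m n (a : 'M[R[i]]_(m, n)) (x : 'M[V]_n)
      (b : 'M[R[i]]_(n, m)),
    mxnorm m (mxact a x b) <= opnorm a * mxnorm n x * opnorm b
}.

#[short(type="operatorSpaceType")]
HB.structure Definition OperatorSpace (R : realType) :=
  {V of isOperatorSpace R V & GRing.Lmodule R[i] V}.

Arguments mxnorm {R V n} : rename.

Section CompletelyBounded.
Context {R : realType} {X Y : operatorSpaceType R}.
Implicit Type f : {linear X -> Y}.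

Definition cbnorm f : \bar R :=
  ereal_sup [set r | exists n (x : 'M[X]_n),
    mxnorm x <= 1 /\ r = (mxnorm (map_mx f x))%:E].

Definition completely_bounded f := (cbnorm f < +oo)%E.

Definition completely_contractive f := (cbnorm f <= 1)%E.

Definition complete_isometry f :=
  forall n (x : 'M[X]_n), mxnorm (map_mx f x) = mxnorm x.

End CompletelyBounded.

Definition injective_operator_space (R : realType) (Y : operatorSpaceType R) :=
  forall (X0 X1 : operatorSpaceType R) (phi : {linear X0 -> X1})
    (psi0 : {linear X0 -> Y}),
    complete_isometry phi -> completely_bounded psi0 ->
    exists psi : {linear X1 -> Y},
      [/\ completely_bounded psi, psi \o phi =1 psi0 & cbnorm psi = cbnorm psi0].

(* The linear subspace W, with the inherited operator space structure. *)
Section Subspace.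
Context {R : realType} {X : operatorSpaceType R} (W : submodClosed X).

Definition sub_operator_space : Type := {x : X | x \in W}.

HB.instance Definition _ := SubChoice.on sub_operator_space.
HB.instance Definition _ := [SubChoice_isSubLmodule of sub_operator_space by <:].

Let val_mx n (x : 'M[sub_operator_space]_n) : 'M[X]_n := map_mx val x.

Let sub_mxnorm_eq0 n (x : 'M[sub_operator_space]_n) :
  mxnorm (val_mx x) = 0 -> x = 0.
Proof.
move=> /mxnorm_eq0 /matrixP x0; apply/matrixP => i j.
by apply: val_inj; have := x0 i j; rewrite !mxE.
Qed.

Let sub_mxnormD n (x y : 'M[sub_operator_space]_n) :
  mxnorm (val_mx (x + y)) <= mxnorm (val_mx x) + mxnorm (val_mx y).
Proof. by rewrite /val_mx raddfD mxnormD. Qed.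

Let sub_mxnormZ n (c : R[i]) (x : 'M[sub_operator_space]_n) :
  mxnorm (val_mx (map_mx ( *:%R c) x)) = normc c * mxnorm (val_mx x).
Proof.
by rewrite -mxnormZ; congr mxnorm; apply/matrixP => i j; rewrite !mxE linearZ.
Qed.

Let sub_mxnorm_block m n (x : 'M[sub_operator_space]_m)
    (y : 'M[sub_operator_space]_n) :
  mxnorm (val_mx (block_mx x 0 0 y)) =
  Num.max (mxnorm (val_mx x)) (mxnorm (val_mx y)).
Proof. by rewrite -mxnorm_block /val_mx map_block_mx !raddf0. Qed.

Let sub_mxnorm_act m n (a : 'M[R[i]]_(m, n)) (x : 'M[sub_operator_space]_n)
    (b : 'M[R[i]]_(n, m)) :
  mxnorm (val_mx (mxact a x b)) <= opnorm a * mxnorm (val_mx x) * opnorm b.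
Proof.
suff -> : val_mx (mxact a x b) = mxact a (val_mx x) b by exact: mxnorm_act.
apply/matrixP => i j; rewrite !mxE raddf_sum; apply: eq_bigr => k _.
by rewrite raddf_sum; apply: eq_bigr => l _; rewrite !mxE; exact: linearZ.
Qed.

HB.instance Definition _ := isOperatorSpace.Build R sub_operator_space
  sub_mxnorm_eq0 sub_mxnormD sub_mxnormZ sub_mxnorm_block sub_mxnorm_act.

End Subspace.

(* The dual operator space P^*: the bounded functionals on P, with
   M_n(P^* ) normed as CB(P, M_n), where M_k(M_n) is identified with M_kn. *)
Section Dual.
Context {R : realType} (P : operatorSpaceType R).

Definition bounded_functional : {pred P -> R[i]^o} := [pred f | `[<
  scalar f /\
  exists M : R, forall p : P,
    normc (f p) <= M * mxnorm (const_mx p : 'M[P]_1) >]].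

Lemma bounded_functional_submod_closed : submod_closed bounded_functional.
Proof.
split=> [|a f g /asboolP[flin [M fM]] /asboolP[glin [N gN]]]; apply/asboolP.
  split=> [b p q|]; first by rewrite /= mulr0 addr0.
  by exists 0 => p; rewrite mul0r ComplexField.Normc.normc0.
split=> [b p q|].
  by rewrite !fctE flin glin /GRing.scale/=; ring.
exists (normc a * M + N) => p; rewrite mulrDl -mulrA.
rewrite (le_trans (le_normcD _ _))// lerD//.
rewrite ComplexField.Normc.normcM ler_wpM2l//.
by case: (a) => ? ?; exact: sqrtr_ge0.
Qed.

HB.instance Definition _ := GRing.isSubmodClosed.Build R[i] (P -> R[i]^o)
  bounded_functional bounded_functional_submod_closed.

Definition dual_space : Type := {f : P -> R[i]^o | f \in bounded_functional}.

HB.instance Definition _ := SubChoice.on dual_space.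
HB.instance Definition _ := [SubChoice_isSubLmodule of dual_space by <:].

Definition dual_mxnorm n (f : 'M[dual_space]_n) : \bar R :=
  ereal_sup [set r | exists m (p : 'M[P]_m), mxnorm p <= 1 /\
    r = (opnorm (\mxblock_(k < m, l < m)
                   \matrix_(i < n, j < n) (val (f i j) (p k l) : R[i])))%:E].

End Dual.

(* X is (completely isometrically) the operator space dual of the predual. *)
Record dualOperatorSpace (R : realType) (X : operatorSpaceType R) := {
  predual : operatorSpaceType R;
  to_dual : {linear X -> dual_space predual};
  to_dual_bij : bijective to_dual;
  to_dual_isometry : forall n (x : 'M[X]_n),
    dual_mxnorm (map_mx to_dual x) = (mxnorm x)%:E
}.

Definition weak_star (R : realType) (X : operatorSpaceType R)
    (D : dualOperatorSpace X) : Type :=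
  initial_topology
    (fun x : X => val (to_dual D x) : prod_topology (fun _ : predual D => R[i]^o)).

HB.instance Definition _ (R : realType) (X : operatorSpaceType R)
  (D : dualOperatorSpace X) := Topological.on (weak_star D).

Definition weak_star_continuous (R : realType) (X : operatorSpaceType R)
    (D : dualOperatorSpace X) (s : X -> X) :=
  continuous (s : weak_star D -> weak_star D).

(* F_b(S), as a subspace of S -> C *)
Section BoundedFunctions.
Context (R : realType) (S : Type).

Definition bounded_function : {pred S -> R[i]^o} :=
  [pred f | `[< exists M : R, forall s, normc (f s) <= M >]].

Lemma bounded_function_submod_closed : submod_closed bounded_function.
Proof.
split=> [|a f g /asboolP[M fM] /asboolP[N gN]]; apply/asboolP.
  by exists 0 => s; rewrite ComplexField.Normc.normc0.
exists (normc a * M + N) => s.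
rewrite (le_trans (le_normcD _ _))// lerD//.
rewrite ComplexField.Normc.normcM ler_wpM2l//.
by case: (a) => ? ?; exact: sqrtr_ge0.
Qed.

HB.instance Definition _ := GRing.isSubmodClosed.Build R[i] (S -> R[i]^o)
  bounded_function bounded_function_submod_closed.

Definition Fb : Type := {f : S -> R[i]^o | f \in bounded_function}.

HB.instance Definition _ := SubChoice.on Fb.
HB.instance Definition _ := [SubChoice_isSubLmodule of Fb by <:].

Definition supnorm (f : Fb) : R := sup (range (fun s => normc (val f s))).

Definition Fb_functional_norm (mu : {scalar Fb}) : \bar R :=
  ereal_sup [set (normc (mu f))%:E | f in [set f | supnorm f <= 1]].

Lemma Fb_one_subproof : (fun=> 1 : R[i]^o) \in bounded_function.
Proof. by apply/asboolP; exists (normc (1 : R[i])). Qed.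

Definition Fb_one : Fb := Sub (fun=> 1 : R[i]^o) Fb_one_subproof.

End BoundedFunctions.

Section Amenable.
Context (R : realType) (S : semigroupType).

Lemma Fb_translate_subproof (t : S) (f : Fb R S) :
  (fun s => val f (t * s)%g) \in @bounded_function R S.
Proof.
by apply/asboolP; have /asboolP[M fM] := valP f; exists M => s; exact: fM.
Qed.

Definition Fb_translate (t : S) (f : Fb R S) : Fb R S :=
  Sub (fun s => val f (t * s)%g) (Fb_translate_subproof t f).

Definition amenable := exists mu : {scalar Fb R S},
  [/\ Fb_functional_norm mu = 1%E, mu (Fb_one R S) = 1
    & forall t f, mu (Fb_translate t f) = mu f].

End Amenable.

Lemma linear_ext (K : pzRingType) (U V : lmodType K) (f g : {linear U -> V}) :
  f =1 g -> f = g.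
Proof.
move=> /funext; case: f => f cf; case: g => g cg /= fg.
case: _ / fg in cg *; congr GRing.Linear.Pack.
case: cf cg => [[a] [b]] [[c] [d]].
by rewrite (Prop_irrelevance a c) (Prop_irrelevance b d).
Qed.

(* A set of linear maps X -> X closed under composition, viewed as an abstract
   semigroup with s * t = s \o t. *)
Record mapSemigroup (R : realType) (X : operatorSpaceType R) := {
  maps : set {linear X -> X};
  maps_comp : forall s t : {linear X -> X},
    maps s -> maps t -> maps (s \o t)
}.

Section MapSemigroup.
Context {R : realType} {X : operatorSpaceType R} (S : mapSemigroup X).

Definition elements : Type := {s : {linear X -> X} | s \in maps S}.

HB.instance Definition _ := gen_eqMixin elements.
HB.instance Definition _ := gen_choiceMixin elements.

Lemma elements_comp_subproof (s t : elements) :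
  (val s \o val t : {linear X -> X}) \in maps S.
Proof. by rewrite inE; apply: maps_comp; apply: set_mem; exact: valP. Qed.

Definition elements_comp (s t : elements) : elements :=
  exist _ (val s \o val t : {linear X -> X}) (elements_comp_subproof s t).

Lemma elements_compA : associative elements_comp.
Proof. by move=> s t u; apply: eq_exist; apply: linear_ext. Qed.

HB.instance Definition _ := isSemigroup.Build elements elements_compA.

Definition fixed_points : {pred X} :=
  [pred x | `[< forall s : {linear X -> X}, maps S s -> s x = x >]].

Lemma fixed_points_submod_closed : submod_closed fixed_points.
Proof.
split=> [|a x y /asboolP fx /asboolP fy]; apply/asboolP => s Ss.
  exact: linear0.
by rewrite linearP fx ?fy.
Qed.

HB.instance Definition _ := GRing.isSubmodClosed.Build R[i] X
  fixed_points fixed_points_submod_closed.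

End MapSemigroup.

(* Main.v *)
(* Averaging the orbit of x against an invariant mean mu on S, by
   <E x, p> = mu (s |-> <s x, p>), defines a linear map E on X = P^*. As mu has
   norm one, E is completely contractive, and E fixes X^S since mu(1) = 1. For t
   in S, weak*-continuity makes <t _, p> = <_, q> for some q in P, so that
   <t (E x), p> = mu (s |-> <t (s x), p>) = <E x, p> by invariance: E is a
   completely contractive projection onto X^S. Composing an extension with
   values in X with E gives one with values in X^S. *)

Require Import Defs.
From HB Require Import structures.
From mathcomp Require Import all_boot all_order all_algebra.
From mathcomp Require Import complex.
From mathcomp Require Import all_classical all_reals all_analysis.
From mathcomp Require Import ring lra.

Set Implicit Arguments.
Unset Strict Implicit.
Unset Printing Implicit Defensive.

Import Order.TTheory GRing.Theory Num.Theory.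
Import numFieldNormedType.Exports.

Local Open Scope classical_set_scope.
Local Open Scope ring_scope.

(** * Complex moduli, Euclidean norms and operator norms of matrices *)

Section ComplexMatrices.
Context {R : realType}.
Implicit Types z : R[i].

Lemma normc_ge0 z : 0 <= normc z.
Proof. by case: z => a b; exact: sqrtr_ge0. Qed.

Lemma normc_ofreal (r : R) : normc (r%:C)%C = `|r|.
Proof. by rewrite /= expr0n addr0 sqrtr_sqr. Qed.

Lemma le_normc_sum (I : Type) (r : seq I) (P : pred I) (F : I -> R[i]) :
  normc (\sum_(i <- r | P i) F i) <= \sum_(i <- r | P i) normc (F i).
Proof.
elim/big_rec2: _ => [|i y1 y2 _ le12].
  by rewrite ComplexField.Normc.normc0.
by rewrite (le_trans (le_normcD _ _))// lerD2l.
Qed.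

Lemma real_complex_sum n (f : 'I_n -> R) :
  ((\sum_i f i)%:C = \sum_i (f i)%:C :> R[i])%C.
Proof. exact: (rmorph_sum (real_complex R)). Qed.

Lemma mulJc z : (z^* * z)%C = (((normc z ^+ 2 : R))%:C)%C :> R[i].
Proof.
case: z => a b; rewrite /= sqr_sqrtr ?addr_ge0 ?sqr_ge0//.
by apply/eqP; rewrite eq_complex /=; apply/andP; split; apply/eqP; ring.
Qed.

Lemma normcJ z : normc (z^*)%C = normc z.
Proof. by case: z => a b /=; rewrite sqrrN. Qed.

Lemma l2norm_ge0 n (v : 'cV[R[i]]_n) : 0 <= l2norm v.
Proof. exact: sqrtr_ge0. Qed.

Lemma l2normX2 n (v : 'cV[R[i]]_n) : l2norm v ^+ 2 = \sum_i normc (v i 0) ^+ 2.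
Proof. by rewrite sqr_sqrtr// sumr_ge0// => i _; exact: sqr_ge0. Qed.

Lemma normc_le_l2norm n (v : 'cV[R[i]]_n) i : normc (v i 0) <= l2norm v.
Proof.
rewrite -(@ler_pXn2r _ 2)// ?nnegrE ?normc_ge0 ?l2norm_ge0// l2normX2.
by rewrite (bigD1 i)//= lerDl sumr_ge0// => j _; exact: sqr_ge0.
Qed.

Lemma l2norm_delta n (i : 'I_n) : l2norm (delta_mx i 0 : 'cV[R[i]]_n) = 1.
Proof.
rewrite /l2norm (bigD1 i)//= big1 => [|j ji]; last first.
  by rewrite mxE (negbTE ji) ComplexField.Normc.normc0 expr0n.
by rewrite mxE !eqxx ComplexField.Normc.normc1 expr1n addr0 sqrtr1.
Qed.

(** On the unit ball every coordinate has modulus at most 1, so the absolute row sums bound the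
    coordinates of the image. Only for a bounded set is [sup] known to be an upper bound. *)
Lemma opnorm_has_ubound m n (A : 'M[R[i]]_(m, n)) :
  has_ubound [set l2norm (A *m v) | v in [set v : 'cV_n | l2norm v <= 1]].
Proof.
exists (Num.sqrt (\sum_i (\sum_j normc (A i j)) ^+ 2)) => _ [v v1 <-].
rewrite ler_wsqrtr// ler_sum// => i _.
rewrite ler_pXn2r ?nnegrE ?normc_ge0 ?sumr_ge0// => [|j _]; last first.
  exact: normc_ge0.
rewrite mxE (le_trans (le_normc_sum _ _ _))// ler_sum// => j _.
rewrite ComplexField.Normc.normcM ler_piMr ?normc_ge0//.
exact: le_trans (normc_le_l2norm _ _) v1.
Qed.

Lemma l2norm_mulmx_le m n (A : 'M[R[i]]_(m, n)) (v : 'cV_n) :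
  l2norm v <= 1 -> l2norm (A *m v) <= opnorm A.
Proof. by move=> v1; apply: ub_le_sup; [exact: opnorm_has_ubound|exists v]. Qed.

Lemma l2norm0 n : l2norm (0 : 'cV[R[i]]_n) = 0.
Proof.
rewrite /l2norm big1 ?sqrtr0// => i _.
by rewrite mxE ComplexField.Normc.normc0 expr0n.
Qed.

Lemma opnorm_le m n (A : 'M[R[i]]_(m, n)) (C : R) :
  (forall v : 'cV_n, l2norm v <= 1 -> l2norm (A *m v) <= C) -> opnorm A <= C.
Proof.
move=> leAC; apply: ge_sup => [|_ [v v1 <-]]; last exact: leAC.
by exists (l2norm (A *m 0)); exists 0 => //=; rewrite l2norm0.
Qed.

(** The entry is a coordinate of the image of the [j]-th unit vector. *)
Lemma normc_le_opnorm m n (A : 'M[R[i]]_(m, n)) i j : normc (A i j) <= opnorm A.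
Proof.
apply: le_trans (l2norm_mulmx_le _ (_ : l2norm (delta_mx j 0) <= 1)).
  by rewrite -colE; have := normc_le_l2norm (col j A) i; rewrite mxE.
by rewrite l2norm_delta.
Qed.

End ComplexMatrices.

(** * Elementary properties of matrix norms *)

Section OperatorSpaces.
Context {R : realType}.
Implicit Types X Y : operatorSpaceType R.

Lemma mxnorm0 X n : mxnorm (0 : 'M[X]_n) = 0.
Proof.
have -> : (0 : 'M[X]_n) = map_mx ( *:%R 0) 0.
  by apply/matrixP => i j; rewrite !mxE scale0r.
by rewrite mxnormZ ComplexField.Normc.normc0 mul0r.
Qed.

(** Nonnegativity is not among the axioms; it follows from the triangle inequality for [x] and [-x],
    which have the same norm. *)
Lemma mxnorm_ge0 X n (x : 'M[X]_n) : 0 <= mxnorm x.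
Proof.
have := mxnormD _ x (map_mx ( *:%R (-1)) x).
rewrite mxnormZ normcN ComplexField.Normc.normc1 mul1r.
suff -> : x + map_mx ( *:%R (-1)) x = 0 by rewrite mxnorm0; lra.
by apply/matrixP => i j; rewrite !mxE scaleN1r subrr.
Qed.

Lemma normalize_mx X n (x : 'M[X]_n) : x != 0 -> exists (c : R) (y : 'M[X]_n),
  [/\ 0 < c, c = mxnorm x, x = map_mx ( *:%R (c%:C)%C) y & mxnorm y = 1].
Proof.
move=> x0; have c0 : 0 < mxnorm x.
  by rewrite lt0r mxnorm_ge0 andbT; apply: contra x0 => /eqP/mxnorm_eq0 ->.
have cC : ((mxnorm x)%:C)%C != 0 :> R[i].
  by rewrite (inj_eq (@complexI R)) gt_eqF.
exists (mxnorm x), (map_mx ( *:%R ((mxnorm x)%:C)%C^-1) x); split=> //.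
  by apply/matrixP => i j; rewrite !mxE scalerA mulfV// scale1r.
rewrite mxnormZ ComplexField.Normc.normcV normc_ofreal ger0_norm ?ltW//.
by rewrite mulVf// gt_eqF.
Qed.

(** [cbnorm] only sees matrices in the unit ball; homogeneity carries the bound to all matrices. *)
Lemma completely_contractiveP X Y (f : {linear X -> Y}) :
  completely_contractive f ->
  forall n (x : 'M[X]_n), mxnorm (map_mx f x) <= mxnorm x.
Proof.
move=> f1 n x; have [->|/normalize_mx [c [y [c0 cE xE y1]]]] := eqVneq x 0.
  by rewrite raddf0 !mxnorm0.
have -> : map_mx f x = map_mx ( *:%R (c%:C)%C) (map_mx f y).
  by rewrite {1}xE; apply/matrixP => i j; rewrite !mxE linearZ.
rewrite mxnormZ normc_ofreal gtr0_norm// -cE ler_piMr ?(ltW c0)//.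
rewrite -lee_fin; apply: le_trans f1; apply: ereal_sup_ubound.
by exists n, y; rewrite y1.
Qed.

End OperatorSpaces.

(** * Linear forms vanishing on a finite intersection of kernels *)

Section LinearForms.
Context {K : fieldType} {P V : lmodType K} (b : P -> V -> K).
Hypothesis b_linl : forall a p q x, b (a *: p + q) x = a * b p x + b q x.
Hypothesis b_linr : forall a p x y, b p (a *: x + y) = a * b p x + b p y.

(** Induction on [L], removing one form at a time. The resulting combination of forms is again some
    [b q] because [b] is linear in its first argument. *)
Lemma linear_form_pairing (L : seq P) (f : V -> K) :
  (forall a x y, f (a *: x + y) = a * f x + f y) ->
  (forall x, (forall p, p \in L -> b p x = 0) -> f x = 0) ->
  exists q, forall x, f x = b q x.
Proof.
have b0l x : b 0 x = 0.
  have := b_linl (-1) 0 0 x.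
  by rewrite scaler0 addr0 mulN1r addNr.
elim: L f => [|p L IH] f flin fL; first by exists 0 => x; rewrite fL// b0l.
have [pL|] := pselect (forall x, (forall q, q \in L -> b q x = 0) -> b p x = 0).
  apply: IH => // x xL; apply: fL => q.
  rewrite inE => /predU1P[->|]; last exact: xL.
  exact: pL.
move=> /existsNP[x0 /not_implyP[x0L /eqP px0]].
(* Here [x0] is annihilated by [L] but not by [p]; subtracting this multiple of [b p] makes the form
   vanish at [x0]. *)
have [||q fq] := IH (fun x => f x - f x0 / b p x0 * b p x).
- by move=> a x y; rewrite flin b_linr; ring.
- move=> x xL; apply/eqP; rewrite subr_eq0 eq_sym -subr_eq0; apply/eqP.
  (* Correcting [x] along [x0] makes [b p] vanish as well, so [f] is zero at the corrected
     vector. *)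
  have : f (- (b p x / b p x0) *: x0 + x) = 0.
    apply: fL => q; rewrite inE b_linr => /predU1P[->|qL].
      by rewrite mulNr divfK// addNr.
    by rewrite (x0L q)// (xL q)// mulr0 addr0.
  by rewrite flin => fx; rewrite -oppr0 -[in RHS]fx; ring.
- exists (f x0 / b p x0 *: p + q) => x; rewrite b_linl -fq; ring.
Qed.

End LinearForms.

(** * Functionals of norm one on bounded functions, and their matrix amplifications *)

Section Means.
Context {R : realType} {S : Type} (mu : {scalar Fb R S}).
Context (mu1 : Fb_functional_norm mu = 1%E).

(** The norm of [mu] controls the sup-norm unit ball; dividing by [M] reduces to it, and for [M = 0]
    the function itself vanishes. *)
Lemma normc_mean_le (f : Fb R S) (M : R) :
  0 <= M -> (forall s, normc (val f s) <= M) -> normc (mu f) <= M.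
Proof.
rewrite le_eqVlt => /predU1P[<-|M0] fM.
  suff -> : f = 0 by rewrite linear0 ComplexField.Normc.normc0.
  apply/val_inj/funext => s; apply: ComplexField.Normc.eq0_normc.
  by apply/eqP; rewrite eq_le fM normc_ge0.
have MC0 : (M%:C)%C != 0 :> R[i] by rewrite (inj_eq (@complexI R)) gt_eqF.
have -> : f = (M%:C)%C *: ((M%:C)%C^-1 *: f) by rewrite scalerA mulfV// scale1r.
rewrite linearZ ComplexField.Normc.normcM normc_ofreal gtr0_norm//.
rewrite ler_piMr ?(ltW M0)// -lee_fin -mu1; apply: ereal_sup_ubound.
exists ((M%:C)%C^-1 *: f) => //=; rewrite /supnorm.
(* The range is empty when [S] is; [sup] then takes the value 0, still at most 1. *)
have [->|/set0P ne] :=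
  eqVneq (range (fun s => normc (val ((M%:C)%C^-1 *: f) s))) set0.
  by rewrite sup0.
apply: ge_sup => // _ [s _ <-]; rewrite ComplexField.Normc.normcM.
rewrite ComplexField.Normc.normcV normc_ofreal gtr0_norm// mulrC.
by rewrite ler_pdivrMr// mul1r.
Qed.

Lemma val_Fb_lincomb (I : finType) (a : I -> R[i]) (f : I -> Fb R S) s :
  val (\sum_i a i *: f i) s = \sum_i a i * val (f i) s.
Proof. by rewrite raddf_sum fct_sumE. Qed.

(** This is complete contractivity of [mu]. If [y] is the averaged matrix applied to [v], then
    [|y|^2] is [mu] of the scalar function pairing [F(s) v] with [y], so the scalar bound on [mu]
    suffices. *)
Lemma opnorm_mean_le m n (F : 'M[Fb R S]_(m, n)) (C : R) : 0 <= C ->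
  (forall s, opnorm (\matrix_(i, j) (val (F i j) s : R[i])) <= C) ->
  opnorm (\matrix_(i, j) (mu (F i j) : R[i])) <= C.
Proof.
move=> C0 FC; apply: opnorm_le => v v1; set y := _ *m v.
(* [G i] is the [i]-th coordinate of the vector-valued function [s |-> F(s) v]. *)
pose G i := \sum_j v j 0 *: F i j.
have yE i : y i 0 = mu (G i).
  rewrite mxE linear_sum; apply: eq_bigr => j _.
  by rewrite mxE linearZ mulrC.
clearbody y.
have : normc (mu (\sum_i (y i 0)^*%C *: G i)) <= (l2norm y ^+ 2 + C ^+ 2) / 2.
  apply: normc_mean_le => [|s]; first by rewrite divr_ge0// addr_ge0// sqr_ge0.
  rewrite val_Fb_lincomb; set u := \matrix_(i, j) (val (F i j) s : R[i]) *m v.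
  have u2 : l2norm u ^+ 2 <= C ^+ 2.
    rewrite ler_pXn2r ?nnegrE ?l2norm_ge0//.
    by rewrite (le_trans (l2norm_mulmx_le _ v1)).
  have GE i : val (G i) s = u i 0.
    by rewrite val_Fb_lincomb mxE; apply: eq_bigr => j _; rewrite mxE mulrC.
  apply: (@le_trans _ _ ((l2norm y ^+ 2 + l2norm u ^+ 2) / 2)); last by lra.
  rewrite !l2normX2 -big_split/= mulr_suml (le_trans (le_normc_sum _ _ _))//.
  apply: ler_sum => i _; rewrite GE ComplexField.Normc.normcM normcJ.
  (* AM-GM; with y = F v this yields |y|^2 <= (|y|^2 + C^2) / 2. *)
  by have := sqr_ge0 (normc (y i 0) - normc (u i 0)); nra.
have -> : mu (\sum_i (y i 0)^*%C *: G i) = ((l2norm y ^+ 2)%:C)%C.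
  rewrite linear_sum l2normX2 real_complex_sum; apply: eq_bigr => i _.
  by rewrite linearZ -yE [LHS]mulJc.
rewrite normc_ofreal ger0_norm ?sqr_ge0// => y2.
by rewrite -(@ler_pXn2r _ 2)// ?nnegrE ?l2norm_ge0//; lra.
Qed.

End Means.

(** * The pairing with the predual and the weak* topology *)

Section DualOperatorSpaces.
Context {R : realType} {X : operatorSpaceType R} (D : dualOperatorSpace X).

Definition dual_pairing (x : X) (p : predual D) : R[i] := val (to_dual D x) p.

Lemma dual_pairing_linl a x y p :
  dual_pairing (a *: x + y) p = a * dual_pairing x p + dual_pairing y p.
Proof. by rewrite /dual_pairing linearP. Qed.

Lemma dual_pairing_linr a x p q :
  dual_pairing x (a *: p + q) = a * dual_pairing x p + dual_pairing x q.
Proof. by have /asboolP[xlin _] := valP (to_dual D x); exact: xlin. Qed.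

Lemma dual_pairing_inj x y : dual_pairing x =1 dual_pairing y -> x = y.
Proof.
move=> xy; apply: (bij_inj (to_dual_bij D)).
by apply/val_inj/funext => p; exact: xy.
Qed.

Lemma opnorm_dual_pairing_le n (x : 'M[X]_n) m (p : 'M[predual D]_m) :
  mxnorm p <= 1 ->
  opnorm (\mxblock_(k < m, l < m)
    \matrix_(i < n, j < n) dual_pairing (x i j) (p k l)) <= mxnorm x.
Proof.
move=> p1; rewrite -lee_fin -(to_dual_isometry D); apply: ereal_sup_ubound.
exists m, p; split; first exact: p1.
apply: (congr1 EFin); apply: (congr1 (@opnorm R _ _)).
by apply/matrixP => a b; rewrite !mxE.
Qed.

Lemma dual_pairing0r x : dual_pairing x 0 = 0.
Proof.
have := dual_pairing_linr (-1) x 0 0.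
by rewrite scaler0 addr0 mulN1r addNr.
Qed.

Lemma dual_pairingZr a x p : dual_pairing x (a *: p) = a * dual_pairing x p.
Proof. by rewrite -[a *: p]addr0 dual_pairing_linr dual_pairing0r addr0. Qed.

Lemma dual_pairingZl a x p : dual_pairing (a *: x) p = a * dual_pairing x p.
Proof. by rewrite /dual_pairing linearZ. Qed.

(** After normalizing [p], the pairing is the single entry of a block matrix bounded by the dual
    norm. *)
Lemma normc_dual_pairing_le x p :
  normc (dual_pairing x p) <=
    mxnorm (const_mx x : 'M[X]_1) * mxnorm (const_mx p : 'M[predual D]_1).
Proof.
have [p0|/normalize_mx[c [q [c0 <- pE q1]]]] :=
  eqVneq (const_mx p : 'M[predual D]_1) 0.
  have -> : p = 0 by have /matrixP/(_ 0 0) := p0; rewrite !mxE.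
  by rewrite dual_pairing0r ComplexField.Normc.normc0 mulr_ge0 ?mxnorm_ge0.
have -> : p = (c%:C)%C *: q 0 0 by have /matrixP/(_ 0 0) := pE; rewrite !mxE.
rewrite dual_pairingZr ComplexField.Normc.normcM normc_ofreal gtr0_norm// mulrC.
rewrite ler_wpM2r ?(ltW c0)//.
have := opnorm_dual_pairing_le (const_mx x : 'M[X]_1) (_ : mxnorm q <= 1).
rewrite q1 => /(_ (lexx 1)); apply: le_trans; set B := \mxblock_(k, l) _.
have -> : dual_pairing x (q 0 0) = B (tagnat.Rank 0 0) (tagnat.Rank 0 0).
  by rewrite /B mxE !tagnat.Rank1K !ord1 !mxE.
exact: normc_le_opnorm.
Qed.

(** The topology is initial for a product, so one [p] at a time suffices. Eventual equality of the
    pairings is much stronger than their convergence, but it is what a filter of annihilators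
    provides. *)
Lemma cvg_weak_star (F : set_system X) (x : X) : Filter F ->
  (forall p, \forall y \near F, dual_pairing y p = dual_pairing x p) ->
  F --> (x : weak_star D).
Proof.
move=> FF Fx A [_ [[B oB <-] Bx] sBA].
apply: filterS sBA _.
pose T := prod_topology (fun _ : predual D => R[i]^o).
suff : (fun y : X => val (to_dual D y) : T) @ F --> (val (to_dual D x) : T).
  by apply; exact: open_nbhs_nbhs.
apply/cvg_sup => p C [_ [[E oE <-] Ex] sEC].
apply: filterS (Fx p) => y yx; apply: sEC.
by rewrite /= -/(dual_pairing y p) yx.
Qed.

(* The annihilators of finite subsets of the predual form a filter converging
   weak* to 0; along it [<s x, p>] is eventually less than 1 in modulus, hence
   zero, so [<s _, p>] vanishes on the annihilator of a finite set. *)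
Lemma weak_star_continuous_predual (s : {linear X -> X}) p :
  weak_star_continuous D s ->
  exists q, forall x, dual_pairing (s x) p = dual_pairing x q.
Proof.
move=> sC; pose ann (L : seq (predual D)) : set X :=
  [set x | forall q, q \in L -> dual_pairing x q = 0].
pose F : set_system X := filter_from setT ann.
have FF : Filter F.
  apply: filter_fromT_filter; first by exists [::].
  move=> L L'; exists (L ++ L') => x xLL'.
  by split=> q qL; apply: xLL'; rewrite mem_cat qL ?orbT.
have pairing0l q : dual_pairing 0 q = 0 by rewrite /dual_pairing linear0.
have F0 : F --> (0 : weak_star D).
  apply: cvg_weak_star => q; exists [:: q] => // x xq.
  by rewrite /= pairing0l xq// inE.
have sp : (fun x : weak_star D => dual_pairing (s x) p : R[i]^o)
    @ (0 : weak_star D) --> (dual_pairing (s 0) p : R[i]^o).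
  apply: (@continuous_comp (weak_star D) (weak_star D) R[i]^o s
    (fun x => dual_pairing x p)); first exact: sC.
  apply: (@continuous_comp (weak_star D)
    (prod_topology (fun _ : predual D => R[i]^o)) R[i]^o
    (fun x => val (to_dual D x)) (fun f => f p)).
    exact: initial_continuous.
  exact: (@proj_continuous _ (fun _ : predual D => R[i]^o)).
have [L _ Lsp] : F [set x | `|dual_pairing (s x) p| < 1].
  apply: F0; apply: (sp [set z : R[i]^o | `|z| < 1]).
  rewrite linear0 pairing0l.
  exact: (@pseudometric_normed_Zmodule.nbhs0_lt _ R[i]^o).
apply: (@linear_form_pairing _ _ _ (fun q x => dual_pairing x q) _ _ L).
- by move=> a q r x; exact: dual_pairing_linr.
- by move=> a q x y; exact: dual_pairing_linl.
- by move=> a x y; rewrite linearP dual_pairing_linl.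
move=> x xL; apply/eqP/negPn/negP => sx0.
(* The annihilator is a subspace, so [x] can be rescaled to make the pairing equal to 1, against the
   strict bound. *)
have /Lsp /= : ann L ((dual_pairing (s x) p)^-1 *: x).
  by move=> q qL; rewrite dual_pairingZl xL// mulr0.
by rewrite linearZ dual_pairingZl mulVf// normr1 ltxx.
Qed.

End DualOperatorSpaces.

Arguments dual_pairing {R X} D x p.

(** * The projection onto the fixed points by averaging orbits *)

Section MeanProjection.
Context {R : realType} {X : operatorSpaceType R} (D : dualOperatorSpace X).
Context (S : mapSemigroup X) (mu : {scalar Fb R (elements S)}).
Context (mu_norm : Fb_functional_norm mu = 1%E) (mu_one : mu (Fb_one R _) = 1).
Context (mu_translate : forall t f, mu (Fb_translate t f) = mu f).
Context (S_cc : forall s : {linear X -> X},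
  maps S s -> completely_contractive s).

Lemma elements_maps (s : elements S) : maps S (val s).
Proof. by apply: set_mem; exact: valP. Qed.

(** The bound does not depend on [s]: it puts orbit functions in [Fb], and through [mu] it bounds
    the averaged functional on the predual. *)
Lemma normc_orbit_le x p (s : elements S) :
  normc (dual_pairing D (val s x) p) <=
  mxnorm (const_mx x : 'M[X]_1) * mxnorm (const_mx p : 'M[predual D]_1).
Proof.
apply: le_trans (normc_dual_pairing_le _ _) _; rewrite ler_wpM2r ?mxnorm_ge0//.
rewrite -map_const_mx; exact/completely_contractiveP/S_cc/elements_maps.
Qed.

Lemma orbit_bounded x p :
  (fun s : elements S => dual_pairing D (val s x) p)
    \in @bounded_function R (elements S).
Proof. by apply/asboolP; eexists => s; exact: normc_orbit_le. Qed.

Definition orbit x p : Fb R (elements S) :=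
  Sub (fun s : elements S => dual_pairing D (val s x) p) (orbit_bounded x p).

Lemma orbit_linl a x y p : orbit (a *: x + y) p = a *: orbit x p + orbit y p.
Proof. by apply/val_inj/funext => s; rewrite /= linearP dual_pairing_linl. Qed.

Lemma orbit_linr a x p q : orbit x (a *: p + q) = a *: orbit x p + orbit x q.
Proof. by apply/val_inj/funext => s; rewrite /= dual_pairing_linr. Qed.

(** The averaged functional is bounded on the predual, and [to_dual] is onto the bounded
    functionals. *)
Lemma mean_orbit_exists x :
  exists y, forall p, dual_pairing D y p = mu (orbit x p).
Proof.
have bx : (fun p => mu (orbit x p)) \in @bounded_functional R (predual D).
  apply/asboolP; split=> [a p q|]; first by rewrite orbit_linr linearP.
  exists (mxnorm (const_mx x : 'M[X]_1)) => p.
  apply: (normc_mean_le mu_norm) => [|s]; first by rewrite mulr_ge0 ?mxnorm_ge0.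
  exact: normc_orbit_le.
have [g _ toK] := to_dual_bij D.
exists (g (Sub (fun p => mu (orbit x p)) bx)) => p.
by rewrite /dual_pairing toK.
Qed.

Context (S_ws : forall s : {linear X -> X},
  maps S s -> weak_star_continuous D s).

Lemma mean_projection : exists E : {linear X -> X},
  [/\ forall n (x : 'M[X]_n), mxnorm (map_mx E x) <= mxnorm x,
     forall x, E x \in fixed_points S
   & forall x, x \in fixed_points S -> E x = x].
Proof.
have [E EP] := choice mean_orbit_exists.
have Elin : linear E.
  move=> a x y; apply: (dual_pairing_inj (D := D)) => p.
  by rewrite dual_pairing_linl !EP orbit_linl linearP.
pose EL : {linear X -> X} :=
  HB.pack E (GRing.isLinear.Build R[i] X X *:%R E Elin).
exists EL; split=> [n x|x|x /asboolP xS].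
- rewrite -lee_fin -(to_dual_isometry D).
  apply: ge_ereal_sup => _ [m [p [p1 ->]]]; rewrite lee_fin.
  (* [F] is the block matrix of orbit functions: applying [mu] entrywise gives the pairings of [E x]
     with [p], while its value at [s] gives those of [s x], of norm at most that of [x]. *)
  pose F : 'M[Fb R (elements S)]_(\sum_(k < m) n, \sum_(k < m) n) :=
    \mxblock_(k < m, l < m) \matrix_(i < n, j < n) orbit (x i j) (p k l).
  have -> : \mxblock_(k < m, l < m) \matrix_(i < n, j < n)
      (val (map_mx (to_dual D) (map_mx EL x) i j) (p k l) : R[i]) =
      \matrix_(a, b) (mu (F a b) : R[i]).
    by apply/matrixP => a b; rewrite !mxE; exact: EP.
  apply: (opnorm_mean_le mu_norm) => [|s]; first exact: mxnorm_ge0.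
  apply: (le_trans _ (completely_contractiveP (S_cc (elements_maps s)) x)).
  apply: le_trans; last exact: (opnorm_dual_pairing_le _ p1).
  suff -> : \matrix_(a, b) (val (F a b) s : R[i]) =
    \mxblock_(k < m, l < m) \matrix_(i < n, j < n)
      dual_pairing D (map_mx (val s) x i j) (p k l) by [].
  by apply/matrixP => a b; rewrite !mxE.
- apply/asboolP => s Ss; apply: (dual_pairing_inj (D := D)) => p.
  have [q sq] := weak_star_continuous_predual p (S_ws Ss).
  have sS : s \in maps S by rewrite inE.
  (* By the choice of [q], the translate by [s] of the orbit function at [p] is the orbit function
     at [q]. *)
  rewrite sq !EP -(mu_translate (exist _ s sS : elements S) (orbit x p)).
  by congr (mu _); apply/val_inj/funext => t; rewrite /= sq.
- apply: (dual_pairing_inj (D := D)) => p; rewrite EP.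
  (* A fixed point has constant orbit functions. *)
  have -> : orbit x p = dual_pairing D x p *: Fb_one R _.
    apply/val_inj/funext => s; rewrite /= xS; last exact: elements_maps.
    exact/esym/mulr1.
  rewrite linearZ mu_one; exact: mulr1.
Qed.

End MeanProjection.

(** * Completely bounded norms and injectivity of retracts *)

Section CbNorm.
Context {R : realType}.

Lemma cbnorm_mono (X Y Z : operatorSpaceType R)
    (f : {linear X -> Y}) (g : {linear X -> Z}) :
  (forall n (x : 'M[X]_n), mxnorm (map_mx f x) <= mxnorm (map_mx g x)) ->
  (cbnorm f <= cbnorm g)%E.
Proof.
move=> fg; apply: ge_ereal_sup => _ [n [x [x1 ->]]].
apply: (@le_trans _ _ (mxnorm (map_mx g x))%:E); first by rewrite lee_fin.
by apply: ereal_sup_ubound; exists n, x.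
Qed.

(** As [phi] preserves matrix norms, values of [psi0] on unit balls are values of [psi] on unit
    balls. Hence only the upper bound on the norm of an extension needs an argument. *)
Lemma cbnorm_extension (X0 X1 Y : operatorSpaceType R) (phi : {linear X0 -> X1})
    (psi0 : {linear X0 -> Y}) (psi : {linear X1 -> Y}) :
  complete_isometry phi -> psi \o phi =1 psi0 -> (cbnorm psi0 <= cbnorm psi)%E.
Proof.
move=> phi_iso psiE; apply: ge_ereal_sup => _ [n [x [x1 ->]]].
apply: ereal_sup_ubound; exists n, (map_mx phi x); rewrite phi_iso -map_mx_comp.
by split=> //; congr (mxnorm _)%:E; apply/matrixP => i j; rewrite !mxE -psiE.
Qed.

Lemma injective_operator_space_retract (X : operatorSpaceType R)
    (W : submodClosed X) (E : {linear X -> X}) :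
  (forall n (x : 'M[X]_n), mxnorm (map_mx E x) <= mxnorm x) ->
  (forall x, E x \in W) -> (forall x, x \in W -> E x = x) ->
  injective_operator_space X -> injective_operator_space (sub_operator_space W).
Proof.
move=> E1 EW Eid Xinj X0 X1 phi psi0 phi_iso psi0_cb.
(* The norm of the subspace is by definition the norm after [val], so [incl] is completely isometric
   and composing with it keeps the norm of [psi0]. *)
pose incl : {linear sub_operator_space W -> X} := val.
have inclN n (x : 'M[X0]_n) :
  mxnorm (map_mx (incl \o psi0) x) = mxnorm (map_mx psi0 x).
  by rewrite map_mx_comp.
have inclE : cbnorm (incl \o psi0 : {linear X0 -> X}) = cbnorm psi0.
  by apply/eqP; rewrite eq_le !cbnorm_mono// => n x; rewrite inclN.
have [|psi [psi_cb psiE psi_norm]] :=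
  Xinj _ _ phi (incl \o psi0 : {linear X0 -> X}) phi_iso.
  by rewrite /completely_bounded inclE.
(* The extension obtained in [X] need not take values in [W]; [E] brings it there and leaves the
   values on the image of [phi] unchanged. *)
pose h x : sub_operator_space W := Sub (E (psi x)) (EW _).
have hlin : linear h by move=> a x y; apply/val_inj; rewrite /= !linearP.
pose hL : {linear X1 -> sub_operator_space W} :=
  HB.pack h (GRing.isLinear.Build R[i] X1 _ *:%R h hlin).
have hE : hL \o phi =1 psi0.
  move=> x; apply/val_inj; rewrite /= [psi _]psiE /=; apply: Eid; exact: valP.
have hn : cbnorm hL = cbnorm psi0.
  apply/eqP; rewrite eq_le (cbnorm_extension phi_iso hE) andbT -inclE -psi_norm.
  apply: cbnorm_mono => n x; apply: le_trans (E1 _ _).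
  suff -> : map_mx E (map_mx psi x) = map_mx val (map_mx hL x) by [].
  by apply/matrixP => i j; rewrite !mxE.
by exists hL; split=> //; rewrite /completely_bounded hn.
Qed.

End CbNorm.

Theorem corollary3p2 (R : realType) (X : operatorSpaceType R)
    (D : dualOperatorSpace X) (S : mapSemigroup X) :
  amenable R (elements S) ->
  (forall s : {linear X -> X}, maps S s ->
     completely_contractive s /\ weak_star_continuous D s) ->
  injective_operator_space X ->
  injective_operator_space (sub_operator_space (fixed_points S)).
Proof.
move=> [mu [mu_norm mu_one mu_inv]] SP.
have [E [E1 EW Eid]] := mean_projection mu_norm mu_one mu_inv
  (fun s Ss => (SP s Ss).1) (fun s Ss => (SP s Ss).2).
exact: injective_operator_space_retract E1 EW Eid.
Qed.
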